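(* Let $\mathcal{A}\subseteq\mathbb{R}^k$ be a finite nonempty set with $n=|\mathcal{A}|$, $d$ a metric on $\mathbb{R}^k$, $q\ge1$, $C>0$, $\alpha>0$. If $$\alpha\le\min\left\{\frac{1}{2^q}\,\frac{\operatorname{diam}(\mathcal{A})^q}{n\cdot C},\ \frac1n\right\},$$ then the empty barycenter $\emptyset$ is an optimal solution to the barycenter problem with empty set $\mathrm{Bar}_{C,\alpha}(\mathcal{A})$.
   Context: $d^q(x,y)=(d(x,y))^q$ and $\operatorname{diam}(\mathcal{A})=\max_{a_1,a_2\in\mathcal{A}} d(a_1,a_2)$. Adjoin to $\mathbb{R}^k$ an extra element $\emptyset$ (the ''empty barycenter''). The problem $\mathrm{Bar}_{C,\alpha}(\mathcal{A})$ is to minimize $f_{C,\alpha}(x,\mathcal{A})$ over $x\in\mathbb{R}^k\cup\{\emptyset\}$, where $f_{C,\alpha}(x,\mathcal{A})=\sum_{a\in\mathcal{A}}\min\{d^q(x,a),C\}$ for $x\in\mathbb{R}^k$ and $f_{C,\alpha}(\emptyset,\mathcal{A})=n\cdot\alpha\cdot C$. An optimal solution is a minimizer. *)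

(* Defs.v *)
From mathcomp Require Import all_boot all_order all_algebra.
From mathcomp Require Import finmap.
From mathcomp Require Import reals exp.

Set Implicit Arguments.
Unset Strict Implicit.
Unset Printing Implicit Defensive.

Import Order.TTheory GRing.Theory Num.Theory.
Local Open Scope ring_scope.

(* A predicate rather than a [metricType] structure: the metric need not be
   the one carried by the canonical topology of ['rV[R]_k]. *)
Record is_metric (R : realType) (T : Type) (d : T -> T -> R) : Prop := IsMetric {
  metric_ge0 : forall x y, 0 <= d x y;
  metric_eq0 : forall x y, d x y = 0 <-> x = y;
  metric_sym : forall x y, d x y = d y x;
  metric_triangle : forall x y z, d x z <= d x y + d y z
}.

Section Barycenter.
Variables (R : realType) (k : nat).
Variable d : 'rV[R]_k -> 'rV[R]_k -> R.

(* The default value 0 of the iterated maxima does not affect the result: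
   distances are nonnegative and the set is nonempty in use. *)
Definition diam (A : {fset 'rV[R]_k}) : R :=
  \big[Num.max/0]_(a1 <- A) \big[Num.max/0]_(a2 <- A) d a1 a2.

(* [None] is the empty barycenter. *)
Definition bar_cost (q C alpha : R) (A : {fset 'rV[R]_k})
    (x : option 'rV[R]_k) : R :=
  match x with
  | Some x => \sum_(a <- A) Num.min (d x a `^ q) C
  | None => #|` A|%:R * alpha * C
  end.

Definition bar_optimal (q C alpha : R) (A : {fset 'rV[R]_k})
    (x : option 'rV[R]_k) : Prop :=
  forall y : option 'rV[R]_k, bar_cost q C alpha A x <= bar_cost q C alpha A y.

End Barycenter.

(* Main.v *)
Require Import Defs.
From mathcomp Require Import all_boot all_order all_algebra.
From mathcomp Require Import finmap.
From mathcomp Require Import reals exp.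

Import Order.TTheory GRing.Theory Num.Theory.
Local Open Scope ring_scope.

(* By the triangle inequality, every point x is at distance at least
   diam(A)/2 from some a in A; the term of that single a already gives
   f(x) >= min((diam(A)/2)^q, C) >= n alpha C. *)

(** The two bounds on [alpha] match the two arguments of the [min] in the term of the far point [a]:
    the first gives n alpha C <= (diam(A)/2)^q <= d(x,a)^q, the second n alpha C <= C.
    [exists_half_diam_le] supplies [a], and [bar_cost_ge_term] drops the other, nonnegative
    terms. *)

Lemma diam_ge0 {R : realType} {k : nat} {d : 'rV[R]_k -> 'rV[R]_k -> R}
    (A : {fset 'rV[R]_k}) :
  is_metric d -> 0 <= diam d A.
Proof.
move=> dm; rewrite /diam.
by elim/big_ind: _ => // [x y x0 _|a1 _]; rewrite ?le_max ?x0 //;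
  elim/big_ind: _ => // [x y x0 _|a2 _]; rewrite ?le_max ?x0 ?(metric_ge0 dm).
Qed.

(** A finite maximum preserves strict bounds; [0 < r] covers the default value 0 of the iterated
    maxima. *)
Lemma diam_lt {R : realType} {k : nat} {d : 'rV[R]_k -> 'rV[R]_k -> R}
    (A : {fset 'rV[R]_k}) (r : R) :
  0 < r -> {in A &, forall a1 a2, d a1 a2 < r} -> diam d A < r.
Proof.
move=> r0 dr; rewrite /diam big_seq.
elim/big_ind: _ => // [x y xr yr|a1 a1A]; first by rewrite gt_max xr.
rewrite big_seq; elim/big_ind: _ => // [x y xr yr|a2 a2A].
  by rewrite gt_max xr.
exact: dr.
Qed.

(** Otherwise all of [A] lies strictly within half the diameter of [x], and the triangle inequality
    through [x] makes the diameter smaller than itself. *)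
Lemma exists_half_diam_le {R : realType} {k : nat}
    {d : 'rV[R]_k -> 'rV[R]_k -> R} (A : {fset 'rV[R]_k}) (x : 'rV[R]_k) :
  is_metric d -> A != fset0 -> exists2 a, a \in A & diam d A / 2 <= d x a.
Proof.
move=> dm /fset0Pn[a0 a0A].
case: (boolP (has (fun a => diam d A / 2 <= d x a) A)) => [/hasP[a aA le_a]|].
  by exists a.
move=> /hasPn far.
have lt_half a : a \in A -> d x a < diam d A / 2.
  by move=> aA; rewrite ltNge; exact: far.
(* Nonemptiness enters here: 0 <= d(x,a0) < diam(A)/2 gives the positivity that [diam_lt] asks
   for. *)
have D0 : 0 < diam d A.
  have := le_lt_trans (metric_ge0 dm x a0) (lt_half _ a0A).
  by rewrite pmulr_lgt0 // invr_gt0.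
suff : diam d A < diam d A by rewrite ltxx.
apply: diam_lt => // a1 a2 a1A a2A.
apply: le_lt_trans (metric_triangle dm a1 x a2) _.
by rewrite (metric_sym dm a1 x) [ltRHS]splitr ltrD // lt_half.
Qed.

Lemma bar_cost_ge_term {R : realType} {k : nat}
    {d : 'rV[R]_k -> 'rV[R]_k -> R} (q C alpha : R) (A : {fset 'rV[R]_k})
    (x a : 'rV[R]_k) :
  0 <= C -> a \in A ->
  Num.min (d x a `^ q) C <= bar_cost d q C alpha A (Some x).
Proof.
move=> C0 aA; rewrite /= (big_fsetD1 a) //= lerDl.
by apply: sumr_ge0 => b _; rewrite le_min powR_ge0.
Qed.

Theorem lemma26 (R : realType) (k : nat) (d : 'rV[R]_k -> 'rV[R]_k -> R)
    (q C alpha : R) (A : {fset 'rV[R]_k})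
    (d_metric : is_metric d) (A_neq0 : A != fset0)
    (q_ge1 : 1 <= q) (C_gt0 : 0 < C) (alpha_gt0 : 0 < alpha)
    (alpha_le : alpha <= Num.min (1 / 2 `^ q * (diam d A `^ q / (#|` A|%:R * C)))
                                 (1 / #|` A|%:R)) :
  bar_optimal d q C alpha A None.
Proof.
case=> [x|//].
have [a aA le_a] := exists_half_diam_le A x d_metric A_neq0.
apply: le_trans (bar_cost_ge_term _ _ _ _ _ _ (ltW C_gt0) aA).
have n0 : 0 < #|` A|%:R :> R by rewrite ltr0n cardfs_gt0.
have D0 := diam_ge0 A d_metric.
move: alpha_le; rewrite /= !le_min => /andP[leD le1]; apply/andP; split.
- apply: (@le_trans _ _ ((diam d A / 2) `^ q)).
    have -> : (diam d A / 2) `^ q = diam d A `^ q / 2 `^ q.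
      (* The inverse of 2 becomes a power with exponent -1, so that [powRAC] can swap it with
         [q]. *)
      by rewrite powRM ?invr_ge0 // -powR_inv1 // powRAC powR_inv1 // powR_ge0.
    rewrite [#|` A|%:R * alpha]mulrC -mulrA -ler_pdivlMr ?mulr_gt0 //.
    by rewrite div1r mulrA [_^-1 * _]mulrC in leD.
  rewrite ge0_ler_powR ?nnegrE ?divr_ge0 ?(metric_ge0 d_metric) //.
  exact: le_trans ler01 q_ge1.
- by rewrite ger_pMl // mulrC -ler_pdivlMr.
Qed.
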